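(* Let $C\subset\mathbb{R}^n$ be a closed cone, let $K\subset C$ be nonempty, closed and unbounded, and let $f:C\to\mathbb{R}$ be continuous on $C$ and weakly homogeneous of degree $\alpha>1$ relative to $K$. For $u\in\mathbb{R}^n$ put $f_u(x):=f(x)+\langle u,x\rangle$. Assume that $f$ is bounded from below on $K$ and that $\operatorname{int}(\mathcal{K}(K,f)^* )$ is nonempty. If $u\in\operatorname{int}(\mathcal{K}(K,f)^* )$, then $\operatorname{Sol}(K,f_u)$ is nonempty and bounded.
   Context: A cone is a nonempty set closed under multiplication by positive scalars. For a nonempty closed set $S\subset\mathbb{R}^n$, the asymptotic cone is $S^{\infty}=\{v\in\mathbb{R}^n:\exists t_k\to+\infty,\ \exists x^k\in S,\ \lim_{k\to\infty} x^k/t_k=v\}$. The dual cone of a cone $D$ is $D^*=\{u\in\mathbb{R}^n:\langle u,v\rangle\ge 0\ \forall v\in D\}$; $\operatorname{int}$ denotes topological interior. $f$ is weakly homogeneous of degree $\alpha>0$ relative to $K$ if there is a continuous function $h:C\to\mathbb{R}$, positively homogeneous of degree $\alpha$ (that is, $h(tx)=t^{\alpha}h(x)$ for all $x\in C$, $t>0$), such that $f(x)-h(x)=o(\|x\|^{\alpha})$ on $K$ (i.e. $(f(x)-h(x))/\|x\|^{\alpha}\to 0$ as $\|x\|\to\infty$ with $x\in K$). Any such $h$ is called an asymptotically homogeneous function of $f$ relative to $K$ and is denoted $f^{\infty}$; all such $h$ have the same values on $K^{\infty}$, so the kernel below does not depend on the choice. For a nonempty closed set $S$ and a continuous function $g$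 on $S$, $\operatorname{Sol}(S,g)$ is the set of global minimizers of $g$ over $S$. The kernel is $\mathcal{K}(K,f):=\operatorname{Sol}(K^{\infty},f^{\infty})$; it is a closed cone whenever it is nonempty (which is the case when $f$ is bounded from below on $K$). *)

(* Defs.v *)
From HB Require Import structures.
From mathcomp Require Import all_boot all_order all_algebra.
From mathcomp Require Import all_classical all_reals all_analysis.
Import Order.TTheory GRing.Theory Num.Theory.
Import numFieldNormedType.Exports.

Set Implicit Arguments.
Unset Strict Implicit.
Unset Printing Implicit Defensive.

Local Open Scope classical_set_scope.
Local Open Scope ring_scope.

(* Points of R^n are row vectors with their library topology. A function
   C -> R is a total function 'rV[R]_n -> R; every condition below only
   depends on its values on C (continuity on C is {within C, continuous f}). *)

Definition dotv (R : realType) (n : nat) (u v : 'rV[R]_n) : R :=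
  \sum_(i < n) u ord0 i * v ord0 i.

(* The library norm on 'rV[R]_n is the sup norm. *)
Definition enorm (R : realType) (n : nat) (x : 'rV[R]_n) : R :=
  Num.sqrt (dotv x x).

Definition is_cone (R : realType) (n : nat) (C : set 'rV[R]_n) : Prop :=
  C !=set0 /\ forall (t : R) x, 0 < t -> C x -> C (t *: x).

Definition asymp_cone (R : realType) (n : nat) (S : set 'rV[R]_n) :
    set 'rV[R]_n :=
  [set v | exists (t : nat -> R) (x : nat -> 'rV[R]_n),
    [/\ t k @[k --> \oo] --> +oo,
        forall k, S (x k) &
        (t k)^-1 *: x k @[k --> \oo] --> v]].

Definition dual_cone (R : realType) (n : nat) (D : set 'rV[R]_n) :
    set 'rV[R]_n :=
  [set u | forall v, D v -> 0 <= dotv u v].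

Definition pos_homogeneous (R : realType) (n : nat) (C : set 'rV[R]_n)
    (alpha : R) (h : 'rV[R]_n -> R) : Prop :=
  forall x (t : R), C x -> 0 < t -> h (t *: x) = t `^ alpha * h x.

Definition asymp_homogeneous (R : realType) (n : nat) (C K : set 'rV[R]_n)
    (alpha : R) (f h : 'rV[R]_n -> R) : Prop :=
  [/\ {within C, continuous h},
      pos_homogeneous C alpha h &
      forall e : R, 0 < e -> \forall M \near +oo, forall x, K x ->
        M <= enorm x -> `|(f x - h x) / enorm x `^ alpha| < e].

Definition weakly_homogeneous (R : realType) (n : nat) (C K : set 'rV[R]_n)
    (alpha : R) (f : 'rV[R]_n -> R) : Prop :=
  0 < alpha /\ exists h, asymp_homogeneous C K alpha f h.

Definition Sol (R : realType) (n : nat) (S : set 'rV[R]_n)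
    (g : 'rV[R]_n -> R) : set 'rV[R]_n :=
  [set x | S x /\ forall y, S y -> g x <= g y].

(* finf stands for any asymptotically homogeneous function of f
   relative to K. *)
Definition asymp_kernel (R : realType) (n : nat) (K : set 'rV[R]_n)
    (finf : 'rV[R]_n -> R) : set 'rV[R]_n :=
  Sol (asymp_cone K) finf.

(* Main.v *)
(* A sublevel set of f_u on K is bounded. Otherwise it contains points x_k with
   |x_k| -> oo and, by compactness of the unit sphere, x_k / |x_k| -> v <> 0 in
   the asymptotic cone of K. Dividing f_u(x_k) <= c by |x_k|^alpha kills the
   linear term since alpha > 1, so finf v <= 0; since f is bounded from below,
   finf >= 0 on the asymptotic cone, hence v lies in the kernel and <u, v> > 0.
   But f(x_k) >= m gives <u, x_k> <= c - m, and dividing by |x_k| yields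
   <u, v> <= 0. Minimizing f_u over a compact piece of K finishes the proof. *)
Require Import Defs.
From HB Require Import structures.
From mathcomp Require Import all_boot all_order all_algebra.
From mathcomp Require Import all_classical all_reals all_analysis.
Import Order.TTheory GRing.Theory Num.Theory.
Import numFieldNormedType.Exports.

Local Open Scope classical_set_scope.
Local Open Scope ring_scope.

(** * Inner product and Euclidean norm *)

Lemma dotvZr {R : realType} {n : nat} (u v : 'rV[R]_n) (c : R) :
  dotv u (c *: v) = c * dotv u v.
Proof.
by rewrite /dotv big_distrr; apply: eq_bigr => i _ /=; rewrite mxE mulrCA.
Qed.

Lemma dotvBZl {R : realType} {n : nat} (u v w : 'rV[R]_n) (c : R) :
  dotv (u - c *: v) w = dotv u w - c * dotv v w.
Proof.
rewrite /dotv big_distrr -sumrB; apply: eq_bigr => i _ /=.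
by rewrite !mxE mulrBl mulrA.
Qed.

Lemma cvg_dotv {R : realType} {n : nat} {I : Type} {F : set_system I}
    {FF : Filter F} (u v : I -> 'rV[R]_n) (a b : 'rV[R]_n) :
  u k @[k --> F] --> a -> v k @[k --> F] --> b ->
  dotv (u k) (v k) @[k --> F] --> dotv a b.
Proof.
move=> ua vb; apply: cvg_big => [|i _]; first exact: add_continuous.
by apply: cvgM; [apply: (cvg_comp u (fun M : 'rV[R]_n => M ord0 i) ua)
  |apply: (cvg_comp v (fun M : 'rV[R]_n => M ord0 i) vb)];
  exact: coord_continuous.
Qed.

Lemma enorm_ge0 {R : realType} {n : nat} (x : 'rV[R]_n) : 0 <= enorm x.
Proof. exact: sqrtr_ge0. Qed.

Lemma sqr_enorm {R : realType} {n : nat} (x : 'rV[R]_n) :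
  enorm x ^+ 2 = dotv x x.
Proof.
by rewrite sqr_sqrtr// sumr_ge0// => i _; rewrite -expr2 sqr_ge0.
Qed.

Lemma enormZ {R : realType} {n : nat} (c : R) (x : 'rV[R]_n) : 0 <= c ->
  enorm (c *: x) = c * enorm x.
Proof.
move=> c0; apply/eqP; rewrite -(eqrXn2 (n := 2))// ?mulr_ge0 ?enorm_ge0//.
rewrite exprMn !sqr_enorm dotvZr /dotv !big_distrr; apply/eqP.
by apply: eq_bigr => i _ /=; rewrite mxE expr2 !mulrA.
Qed.

(** Carries Euclidean bounds over to the sup norm, in which [bounded_set] is stated. *)
Lemma ler_norm_enorm {R : realType} {n : nat} (x : 'rV[R]_n) :
  `|x| <= enorm x.
Proof.
rewrite [leLHS]mx_normrE; apply/bigmax_leP; split; first exact: enorm_ge0.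
move=> [i j] _ /=; rewrite ord1 -sqrtr_sqr ler_sqrt ?sumr_ge0//.
  rewrite /dotv (bigD1 j)//= -expr2 lerDl sumr_ge0// => k _.
  by rewrite -expr2 sqr_ge0.
by move=> k _; rewrite -expr2 sqr_ge0.
Qed.

Lemma enorm_gt0 {R : realType} {n : nat} (x : 'rV[R]_n) : x != 0 ->
  0 < enorm x.
Proof.
by move=> x0; rewrite (lt_le_trans _ (ler_norm_enorm x))// normr_gt0.
Qed.

Lemma enorm_continuous {R : realType} {n : nat} :
  continuous (@enorm R n).
Proof.
move=> x; apply: (continuous_comp (f := fun x => dotv x x) (g := Num.sqrt));
  last exact: sqrt_continuous.
exact: (@cvg_dotv R n _ (nbhs x) _ id id x x).
Qed.

(** * Limits of powers and limits within a subset *)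

Lemma cvg_powRy {R : realType} {I : Type} {F : set_system I} {FF : Filter F}
    (e : I -> R) (b : R) : 0 < b ->
  e k @[k --> F] --> +oo -> e k `^ b @[k --> F] --> +oo.
Proof.
move=> b0 /cvgryPge ey; apply/cvgryPge => A.
near=> k; rewrite (le_trans (ler_norm A))//.
have -> : `|A| = (`|A| `^ b^-1) `^ b.
  by rewrite -powRrM mulVf ?gt_eqF// powRr1.
have le : `|A| `^ b^-1 <= e k by near: k; exact: ey.
have ek0 : 0 <= e k by rewrite (le_trans _ le)// powR_ge0.
by rewrite ge0_ler_powR// ?nnegrE ?powR_ge0// ltW.
Unshelve. all: by end_near. Qed.

Lemma cvg_powRV0 {R : realType} {I : Type} {F : set_system I} {FF : Filter F}
    (e : I -> R) (b : R) : 0 < b ->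
  e k @[k --> F] --> +oo -> (e k `^ b)^-1 @[k --> F] --> 0.
Proof.
move=> b0 ey; apply/gtr0_cvgV0; last exact: cvg_powRy.
by near=> k; rewrite powR_gt0//; near: k; exact: cvgry_gt.
Unshelve. all: by end_near. Qed.

Lemma within_continuous_cvg {T U : topologicalType} {I : Type}
    {F : set_system I} {FF : ProperFilter F} {C : set T} {h : T -> U}
    {y : I -> T} {v : T} :
  {within C, continuous h} -> C v -> (\forall k \near F, C (y k)) ->
  y k @[k --> F] --> v -> h (y k) @[k --> F] --> h v.
Proof.
move=> hC Cv Cy yv A hA; have := hC v A hA.
rewrite /nbhs/= -nbhs_subspace_in// => /yv; rewrite /= nbhs_simpl => Ay.
apply: filterS2 Cy Ay => k Cy Ay; exact: Ay.
Qed.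

(** * Normalized sequences and asymptotic directions *)

Lemma asymp_homogeneous_cvg {R : realType} {n : nat} {C K : set 'rV[R]_n}
    {alpha : R} {f h : 'rV[R]_n -> R} {x : nat -> 'rV[R]_n} {v : 'rV[R]_n} :
  is_cone C -> closed C -> K `<=` C -> asymp_homogeneous C K alpha f h ->
  (forall k, K (x k)) -> enorm (x k) @[k --> \oo] --> +oo ->
  (enorm (x k))^-1 *: x k @[k --> \oo] --> v ->
  f (x k) / enorm (x k) `^ alpha @[k --> \oo] --> h v.
Proof.
move=> [_ Cc] Ccl KC [hC hh fh] Kx ey yv.
have e0 : \forall k \near \oo, 0 < enorm (x k) by exact: cvgry_gt.
have Cy : \forall k \near \oo, C ((enorm (x k))^-1 *: x k).
  by near=> k; apply: Cc; [rewrite invr_gt0; near: k|exact/KC].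
have Cv : C v by apply: closed_cvg yv.
have hv : h ((enorm (x k))^-1 *: x k) @[k --> \oo] --> h v.
  exact: within_continuous_cvg hC Cv Cy yv.
rewrite -[h v]add0r.
have fh0 : (f (x k) - h (x k)) / enorm (x k) `^ alpha @[k --> \oo] --> 0.
  apply/cvgr0Pnorm_lt => eps eps0.
  have [M [_ HM]] := fh _ eps0.
  (* The property holds for thresholds strictly above [M], hence for [M + 1]. *)
  near=> k; apply: (HM (M + 1)); rewrite ?ltrDl//.
  by near: k; exact: cvgry_ge.
refine (cvg_trans (near_eq_cvg _) (cvgD fh0 hv)).
near=> k; have ek : 0 < enorm (x k) by near: k.
rewrite fctE hh ?invr_gt0//; last exact/KC.
have -> : (enorm (x k))^-1 `^ alpha = (enorm (x k) `^ alpha)^-1.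
  by rewrite -powR_inv1 ?enorm_ge0// powRAC powR_inv1 ?powR_ge0.
by rewrite [X in _ + X]mulrC -mulrDl subrK.
Unshelve. all: by end_near. Qed.

(** Since [enorm (x k) / t k] tends to [enorm w > 0], the arbitrary scale [t] of the asymptotic cone
    can be replaced by the norm itself. *)
Lemma cvg_asymp_direction {R : realType} {n : nat} {t : nat -> R}
    {x : nat -> 'rV[R]_n} {w : 'rV[R]_n} :
  w != 0 -> t k @[k --> \oo] --> +oo -> (t k)^-1 *: x k @[k --> \oo] --> w ->
  enorm (x k) @[k --> \oo] --> +oo /\
  (enorm (x k))^-1 *: x k @[k --> \oo] --> (enorm w)^-1 *: w.
Proof.
move=> w0 ty yw; have ew := enorm_gt0 _ w0.
have t0 : \forall k \near \oo, 0 < t k by exact: cvgry_gt.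
have eyw : enorm ((t k)^-1 *: x k) @[k --> \oo] --> enorm w.
  exact: (cvg_comp _ _ yw (@enorm_continuous R n w)).
split.
  apply/cvgryPge => A; near=> k.
  have tk : 0 < t k by near: k.
  have -> : enorm (x k) = t k * enorm ((t k)^-1 *: x k).
    by rewrite enormZ ?invr_ge0 ?ltW// mulVKf ?gt_eqF.
  have le1 : enorm w / 2 <= enorm ((t k)^-1 *: x k).
    by near: k; apply: cvgr_ge eyw _ _; rewrite ltr_pdivrMr// ltr_pMr// ltr1n.
  have le2 : `|A| / (enorm w / 2) <= t k by near: k; exact: cvgry_ge.
  rewrite (le_trans (ler_norm A))//.
  rewrite (le_trans _ (ler_wpM2l (ltW tk) le1))//.
  by rewrite -ler_pdivrMr// divr_gt0.
(* Dividing [(t k)^-1 *: x k] by its own norm cancels [t k]. *)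
refine (cvg_trans (near_eq_cvg _) (cvgZ (cvgV (lt0r_neq0 ew) eyw) yw)).
near=> k.
have tk : 0 < t k by near: k.
rewrite /unstable.inv_fun enormZ ?invr_ge0 ?ltW// scalerA invfM invrK mulrAC.
by rewrite divff ?gt_eqF// mul1r.
Unshelve. all: by end_near. Qed.

(* [ex_bound] does not apply: it requires S to be nonempty. *)
Lemma bounded_setP {R : realType} {V : normedModType R} (S : set V) :
  bounded_set S <-> exists M, forall x, S x -> `|x| <= M.
Proof.
split=> [[M [_ SM]]|[M SM]].
  by exists (M + 1) => x Sx; apply: SM Sx; rewrite ltrDl.
exists M; split=> [|N MN x Sx /=]; first exact: num_real.
exact: le_trans (SM x Sx) (ltW MN).
Qed.

Lemma bounded_set_enorm {R : realType} {n : nat} (S : set 'rV[R]_n) (M : R) :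
  (forall x, S x -> enorm x <= M) -> bounded_set S.
Proof.
move=> SM; apply/bounded_setP; exists M => x Sx.
exact: le_trans (ler_norm_enorm x) (SM x Sx).
Qed.

Lemma unbounded_asymp_direction {R : realType} {n : nat} {S : set 'rV[R]_n} :
  ~ bounded_set S -> exists (x : nat -> 'rV[R]_n) (v : 'rV[R]_n),
  [/\ forall k, S (x k), enorm (x k) @[k --> \oo] --> +oo, v != 0 &
      (enorm (x k))^-1 *: x k @[k --> \oo] --> v].
Proof.
move=> Sunb.
(* The bound [k.+1], rather than [k], makes every [x k] nonzero, so that all normalized points lie
   on the sphere. *)
have /choice[x Sx] : forall k : nat, exists x, S x /\ k.+1%:R <= enorm x.
  move=> k; apply: contrapT => /forallNP Sk; apply: Sunb.
  apply: (bounded_set_enorm _ k.+1%:R) => y Sy.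
  by rewrite leNgt; apply/negP => /ltW ky; apply: (Sk y).
have e0 k : 0 < enorm (x k) by rewrite (lt_le_trans _ (Sx k).2).
pose y k := (enorm (x k))^-1 *: x k.
pose sphere := [set v : 'rV[R]_n | enorm v = 1].
have sphere_compact : compact sphere.
  apply: bounded_closed_compact.
    by apply: (bounded_set_enorm _ 1) => v ->.
  have -> : sphere = @enorm R n @^-1` [set r | r = 1] by [].
  apply: preimage_closed; last exact: closed_eq.
  by move=> v _; exact: enorm_continuous.
have sy k : sphere (y k).
  by rewrite /sphere/= enormZ ?invr_ge0 ?ltW// mulVf// gt_eqF.
have [] := sphere_compact (y @ \oo) _; first by exists 0%N => // k _; exact: sy.
move=> v [sv vy].
(* Indices along which [y] tends to the cluster point [v]. They need not increase: [k <= m k]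
   already forces the norms to infinity. *)
have /choice[m mP] : forall k : nat, exists m, (k <= m)%N /\
    `|v - y m| < k.+1%:R^-1.
  move=> k.
  have [||z [[m km <-] vm]] := vy (y @` [set m | (k <= m)%N])
      (ball v k.+1%:R^-1).
  - by exists k => // m km; exists m.
  - by apply: nbhsx_ballx; rewrite invr_gt0.
  by exists m; split=> //; move: vm; rewrite -ball_normE.
exists (x \o m), v; split.
- by move=> k; exact: (Sx _).1.
- apply/cvgryPge => A; near=> k.
  rewrite /= (le_trans _ (Sx (m k)).2)//.
  rewrite (@le_trans _ _ k%:R)//; last by rewrite ler_nat leqW// (mP k).1.
  by near: k; apply: (cvgry_ge cvgr_idn).
- apply/eqP => v0; have := sv; rewrite /sphere/= v0 -(scale0r 0) enormZ// mul0r.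
  by move/esym/eqP; rewrite oner_eq0.
apply/cvgrPdist_lt => e e_gt0; near=> k.
apply: (lt_trans (mP k).2); near: k.
exact: (near_infty_natSinv_lt (PosNum e_gt0)).
Unshelve. all: by end_near. Qed.

Lemma asymp_homogeneous_ge0 {R : realType} {n : nat} {C K : set 'rV[R]_n}
    {alpha : R} {f h : 'rV[R]_n -> R} {w : 'rV[R]_n} :
  is_cone C -> closed C -> K `<=` C -> 0 < alpha ->
  asymp_homogeneous C K alpha f h -> has_lbound [set f x | x in K] ->
  asymp_cone K w -> 0 <= h w.
Proof.
move=> Cc Ccl KC a0 fh [m fm] [t [x [ty Kx yw]]].
have Cw : C w.
  apply: closed_cvg yw => //; near=> k; apply: Cc.2; last exact/KC.
  by rewrite invr_gt0; near: k; exact: cvgry_gt.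
have [w0 | w0] := eqVneq w 0.
  (* For t ^ alpha = 2, homogeneity at the origin reads h 0 = 2 * h 0. *)
  have [_ hh _] := fh.
  have := hh w (2 `^ alpha^-1) Cw.
  rewrite w0 scaler0 -powRrM mulVf ?gt_eqF// powRr1// powR_gt0// => /(_ isT).
  rewrite mulrDl mul1r => /eqP; rewrite -subr_eq0 opprD addNKr oppr_eq0.
  by move=> /eqP ->.
have [ey yv] := cvg_asymp_direction w0 ty yw.
have hv : 0 <= h ((enorm w)^-1 *: w).
  have fv := asymp_homogeneous_cvg Cc Ccl KC fh Kx ey yv.
  have m0 : m * (enorm (x k) `^ alpha)^-1 @[k --> \oo] --> 0.
    by rewrite -(mulr0 m); apply: cvgMr; exact: cvg_powRV0.
  apply: ler_cvg_to m0 fv _; near=> k.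
  by rewrite ler_wpM2r ?invr_ge0 ?powR_ge0//; apply: fm; exists (x k).
have [_ hh _] := fh.
move: hv; rewrite hh ?invr_gt0 ?enorm_gt0//.
by rewrite pmulr_rge0// powR_gt0// invr_gt0 enorm_gt0.
Unshelve. all: by end_near. Qed.

(** For small [c > 0] the point [u - c *: v] is still in the dual cone; pairing it with [v] gives
    [dotv u v >= c * enorm v ^+ 2]. *)
Lemma interior_dual_cone_gt0 {R : realType} {n : nat} {D : set 'rV[R]_n}
    {u v : 'rV[R]_n} :
  (dual_cone D)° u -> D v -> v != 0 -> 0 < dotv u v.
Proof.
move=> uD Dv v0.
have cu : (u - c *: v) @[c --> (0 : R)] --> u.
  rewrite -[X in _ --> X]subr0 -(scale0r v).
  by apply: cvgB; [exact: cvg_cst|apply: cvgZl; exact: cvg_id].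
have /nbhs_ballP[e /= e0 eD] := cu _ uD.
have := eD (e / 2) _ v Dv; rewrite dotvBZl subr_ge0.
move=> /(_ _)/lt_le_trans; apply.
  by rewrite mulr_gt0 ?divr_gt0// -sqr_enorm exprn_gt0// enorm_gt0.
rewrite -ball_normE/= sub0r normrN gtr0_norm ?divr_gt0//.
by rewrite ltr_pdivrMr// ltr_pMr// ltr1n.
Qed.

Theorem theorem5p1 (R : realType) (n : nat) (C K : set 'rV[R]_n) (alpha : R)
    (f finf : 'rV[R]_n -> R) (u : 'rV[R]_n)
    (C_cone : is_cone C) (C_closed : closed C)
    (K_sub : K `<=` C) (K_nonempty : K !=set0) (K_closed : closed K)
    (K_unbounded : ~ bounded_set K)
    (f_cont : {within C, continuous f})
    (alpha_gt1 : 1 < alpha)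
    (f_whom : weakly_homogeneous C K alpha f)
    (f_finf : asymp_homogeneous C K alpha f finf)
    (f_bounded_below : has_lbound [set f x | x in K])
    (int_nonempty : (dual_cone (asymp_kernel K finf))° !=set0)
    (u_int : (dual_cone (asymp_kernel K finf))° u) :
  let f_u := fun x : 'rV[R]_n => f x + dotv u x in
  Sol K f_u !=set0 /\ bounded_set (Sol K f_u).
Proof.
move=> f_u.
have a0 : 0 < alpha by exact: lt_trans alpha_gt1.
have sublevel_bounded c : bounded_set [set x | K x /\ f_u x <= c].
  apply: contrapT => /unbounded_asymp_direction[x [v [Sx ey v0 yv]]].
  have Kx k : K (x k) by exact: (Sx k).1.
  have e0 : \forall k \near \oo, 0 < enorm (x k) by exact: cvgry_gt.
  have uv : dotv u ((enorm (x k))^-1 *: x k) @[k --> \oo] --> dotv u v.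
    exact: cvg_dotv (cvg_cst _) yv.
  have fv := asymp_homogeneous_cvg C_cone C_closed K_sub f_finf Kx ey yv.
  have v_asymp : asymp_cone K v by exists (@enorm R n \o x), x.
  have finf_v : finf v <= 0.
    (* The linear term is a convergent factor times [enorm (x k)] to the power [1 - alpha], which
       vanishes as [1 < alpha]. *)
    have rhs0 : c * (enorm (x k) `^ alpha)^-1 - dotv u ((enorm (x k))^-1 *: x k)
        * (enorm (x k) `^ (alpha - 1))^-1 @[k --> \oo] --> 0.
      have -> : 0 = c * 0 - dotv u v * 0 by rewrite !mulr0 subr0.
      apply: cvgB; first by apply: cvgMr; exact: cvg_powRV0.
      by apply: cvgM uv _; apply: cvg_powRV0; rewrite ?subr_gt0.
    apply: ler_cvg_to fv rhs0 _; near=> k.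
    have ek : 0 < enorm (x k) by near: k.
    have -> : dotv u ((enorm (x k))^-1 *: x k) / enorm (x k) `^ (alpha - 1)
        = dotv u (x k) / enorm (x k) `^ alpha.
      rewrite dotvZr powRB ?gt_eqF ?implybT// powRr1 ?ltW//.
      by rewrite invfM invrK mulrC -mulrA mulVKf ?gt_eqF// mulrC.
    rewrite -mulrBl ler_wpM2r ?invr_ge0 ?powR_ge0// lerBrDr.
    exact: (Sx k).2.
  have v_ker : asymp_kernel K finf v.
    split=> // w Kw; apply: le_trans finf_v _.
    exact: asymp_homogeneous_ge0 f_finf f_bounded_below Kw.
  have := interior_dual_cone_gt0 u_int v_ker v0; rewrite ltNge => /negP; apply.
  have [m fm] := f_bounded_below.
  have rhs0 : (c - m) * (enorm (x k))^-1 @[k --> \oo] --> 0.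
    by rewrite -(mulr0 (c - m)); apply: cvgMr; apply/gtr0_cvgV0.
  apply: ler_cvg_to uv rhs0 _; near=> k.
  rewrite dotvZr mulrC ler_wpM2r ?invr_ge0 ?enorm_ge0// lerBrDr.
  rewrite (le_trans _ (Sx k).2)// addrC lerD2r.
  by apply: fm; exists (x k).
have [x0 Kx0] := K_nonempty.
have /bounded_setP[M SM] := sublevel_bounded (f_u x0).
(* [A] is compact and contains the sublevel set of [f_u] at height [f_u x0]. *)
pose A := K `&` [set x | `|x| <= M].
have A_compact : compact A.
  apply: bounded_closed_compact.
    by apply/bounded_setP; exists M => x [].
  apply: closedI => //.
  have -> : [set x : 'rV[R]_n | `|x| <= M] = Num.norm @^-1` [set r | r <= M].
    by [].
  apply: preimage_closed; last exact: closed_le.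
  by move=> x _; exact: norm_continuous.
have f_u_cont : {within A, continuous f_u}.
  apply: (@within_continuousD _ _ _ A f (dotv u)).
    by apply: continuous_subspaceW f_cont => x [/K_sub].
  apply: continuous_subspaceT => x.
  exact: (@cvg_dotv R n _ (nbhs x) _ (fun=> u) id u x (cvg_cst _)).
have A0 : A x0 by split=> //; exact: SM.
have [z /set_mem[Kz _] zmin] :=
  EVT_min_rV (ex_intro _ x0 A0) A_compact f_u_cont.
split.
  exists z; split=> // y Ky.
  (* A point of [K] outside that sublevel set has a value above [f_u x0], and [x0] itself lies in
     [A]. *)
  have [yx0|/ltW yx0] := leP (f_u y) (f_u x0).
    by apply/zmin/mem_set; split=> //; exact: SM.
  by apply: le_trans yx0; exact/zmin/mem_set.
(* Every minimizer has value at most [f_u x0], so the same bound [M] applies. *)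
apply/bounded_setP; exists M => x [Kx xmin]; apply: SM.
by split=> //; exact: xmin.
Unshelve. all: by end_near. Qed.
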